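(* Let $s$ be the internal opinion vector of a social trust network, whose $i$-th component is the internal opinion $s_i$ of node $i$, and let $z^*$ be the expressed opinion vector at the Nash equilibrium of the social game in which node $i$ with expressed opinion $z_i$ has cost $$c(z_i)=\alpha_i(z_i-s_i)^2+(1-\alpha_i)\sum_{j\in N^+(i)}|\omega_{ij}|\,\bigl(z_i-\mathrm{sgn}(i,j)\,z_j\bigr)^2 .$$ Then $$z^*=\bigl(\Lambda+(I-\Lambda)L\bigr)^{-1}\Lambda s ,$$ where $\Lambda=\mathrm{diag}(\alpha_1,\ldots,\alpha_n)$, $\alpha_i$ is the confidence index of node $i$, $L$ is the Laplacian matrix of the network, and $I$ is the $n\times n$ identity matrix.
   Context: A social trust network is represented by a directed signed weighted graph $G=(V,E)$ with $V=\{1,\ldots,n\}$, where each arc $(i,j)\in E$ carries a weight $\omega_{ij}$ (a nonzero real number, positive or negative). $N^+(i)$ is the set of successors of node $i$, and $\mathrm{sgn}(i,j)$ is the sign of the nonzero weight $\omega_{ij}$. The adjacency matrix $A=(a_{ij})$ has $a_{ij}=\omega_{ij}$ if $(i,j)\in E$ and $a_{ij}=0$ otherwise; $D$ is the diagonal matrix with $d_{ii}=\sum_{j=1}^n|a_{ij}|$; the Laplacian matrix is $L=D-A$. Each node $i$ has a fixed internal opinion $s_i$ and an expressed opinion $z_i$, with values in $[-1,1]$, and a confidence index $\alpha_i$, a number with values in $[0,1]$ expressing how strongly the node holds to its own internal opinion. At the Nash equilibrium, each node $i$ has the expressed opinion $z_i^*$ that minimizes its cost, i.e. $c'(z_i^*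 )=0$, where the derivative is with respect to the node's own opinion and the other opinions are $z_j=z_j^*$.
   Formalization: The matrix Λ+(I−Λ)L is assumed invertible (it is singular e.g. for one node without arcs and α=0), and arcs (i,i) of negative weight are excluded (with n=1, ω=−1, α=1/2, s=1 the equilibrium is 1/5 but the formula gives 1/3). *)

(* Defs.v *)
From HB Require Import structures.
From mathcomp Require Import all_boot all_order all_algebra.
From mathcomp Require Import all_classical reals topology normedtype derive.
From mathcomp Require Import ring lra.

Set Implicit Arguments.
Unset Strict Implicit.
Unset Printing Implicit Defensive.

Import Order.TTheory GRing.Theory Num.Theory.
Import numFieldNormedType.Exports.

Local Open Scope ring_scope.

Record trust_network (R : realType) (n : nat) := TrustNetwork {
  trust_arc : rel 'I_n;
  trust_weight : 'I_n -> 'I_n -> R;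
  trust_weight_neq0 :
    forall i j : 'I_n, trust_arc i j -> trust_weight i j != 0
}.

Section TrustNetworkTheory.
Context {R : realType} {n : nat}.
Implicit Types (G : trust_network R n) (alpha : 'I_n -> R) (s z : 'cV[R]_n).

Definition successors G (i : 'I_n) : {set 'I_n} :=
  [set j | trust_arc G i j]%SET.

Definition adjacency_mx G : 'M[R]_n :=
  \matrix_(i, j) if trust_arc G i j then trust_weight G i j else 0.

Definition degree_mx G : 'M[R]_n :=
  diag_mx (\row_i \sum_j `|adjacency_mx G i j|).

Definition laplacian_mx G : 'M[R]_n := degree_mx G - adjacency_mx G.

Definition confidence_mx alpha : 'M[R]_n := diag_mx (\row_i alpha i).

Definition opinion_vector (v : 'cV[R]_n) : Prop :=
  forall i, -1 <= v i 0 <= 1.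

Definition cost G alpha s z (i : 'I_n) : R :=
  alpha i * (z i 0 - s i 0) ^+ 2 +
  (1 - alpha i) * \sum_(j in successors G i)
    `|trust_weight G i j| *
      (z i 0 - Num.sg (trust_weight G i j) * z j 0) ^+ 2.

Definition set_opinion z (i : 'I_n) (x : R) : 'cV[R]_n :=
  \col_j if j == i then x else z j 0.

(* Each cost is a convex quadratic polynomial in the node's own opinion, so
   this first-order condition says that no node can lower its cost by changing
   its own opinion alone: see nash_equilibriumP. *)
Definition nash_equilibrium G alpha s z : Prop :=
  forall i, is_derive (z i 0) (1 : R)
              (fun x : R => cost G alpha s (set_opinion z i x) i) (0 : R).

Lemma cost_quadratic G alpha s z i : 0 <= alpha i <= 1 ->
  exists a b c : R, 0 <= a /\
    forall x, cost G alpha s (set_opinion z i x) i = a * x ^+ 2 + b * x + c.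
Proof.
move=> /andP[a0 a1].
pose w j := trust_weight G i j.
pose u j : R := if j == i then 1 - Num.sg (w j) else 1.
pose v j : R := if j == i then 0 else Num.sg (w j) * z j 0.
pose S (F : 'I_n -> R) := \sum_(j in successors G i) `|w j| * F j.
exists (alpha i + (1 - alpha i) * S (fun j => u j ^+ 2)),
  (- 2 * (alpha i * s i 0) - 2 * ((1 - alpha i) * S (fun j => u j * v j))),
  (alpha i * s i 0 ^+ 2 + (1 - alpha i) * S (fun j => v j ^+ 2)).
split.
  rewrite addr_ge0// mulr_ge0 ?subr_ge0//.
  by apply: sumr_ge0 => j _; rewrite mulr_ge0// sqr_ge0.
move=> x; rewrite /cost !mxE eqxx.
rewrite (_ : \sum_(j in _) _ = S (fun j => u j ^+ 2) * x ^+ 2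
   - 2 * S (fun j => u j * v j) * x + S (fun j => v j ^+ 2)); first by ring.
rewrite /S mulr_sumr !mulr_suml -sumrB -big_split/=; apply: eq_bigr => j _.
by rewrite !mxE /u /v; case: eqP => _; rewrite -/(w j); ring.
Qed.

Lemma is_derive_quadratic (a b c x : R) :
  is_derive x (1 : R) (fun t : R => a * t ^+ 2 + b * t + c) (2 * a * x + b).
Proof.
apply: is_derive_eq.
by rewrite /GRing.scale/=; ring.
Qed.

Lemma nash_equilibriumP G alpha s z : (forall i, 0 <= alpha i <= 1) ->
  nash_equilibrium G alpha s z <->
  forall i x, cost G alpha s z i <= cost G alpha s (set_opinion z i x) i.
Proof.
move=> alpha01.
have zE i : z = set_opinion z i (z i 0).
  by apply/matrixP => j k; rewrite ord1 !mxE; case: eqP => [->|].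
have crit (i : 'I_n) a b c :
    (forall x, cost G alpha s (set_opinion z i x) i = a * x ^+ 2 + b * x + c) ->
    is_derive (z i 0) (1 : R)
      (fun x : R => cost G alpha s (set_opinion z i x) i) (2 * a * z i 0 + b).
  by move=> fE; rewrite (funext fE); exact: is_derive_quadratic.
split=> [nash i x|minz i].
  have [a [b [c [a0 fE]]]] := cost_quadratic G s z (alpha01 i).
  have D0 : 2 * a * z i 0 + b = 0.
    by rewrite -(@derive_val _ _ _ _ _ _ _ (crit i a b c fE)) (@derive_val _ _ _ _ _ _ _ (nash i)).
  rewrite {1}(zE i) !fE -subr_ge0.
  rewrite (_ : _ - _ = a * (x - z i 0) ^+ 2 + (2 * a * z i 0 + b) * (x - z i 0));
    last by ring.
  by rewrite D0 mul0r addr0 mulr_ge0// sqr_ge0.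
have [a [b [c [a0 fE]]]] := cost_quadratic G s z (alpha01 i).
suff <- : 2 * a * z i 0 + b = 0 by exact: crit fE.
have d x : 0 <= a * (x - z i 0) ^+ 2 + (2 * a * z i 0 + b) * (x - z i 0).
  by have := minz i x; rewrite {1}(zE i) !fE -subr_ge0; congr (0 <= _); ring.
move: (2 * a * z i 0 + b) d => g d.
have a1 : 0 < a + 1 by lra.
have := d (z i 0 - g / (a + 1)); rewrite [leRHS](_ : _ = - (g ^+ 2 / (a + 1) ^+ 2));
  last by field; rewrite gt_eqF.
rewrite oppr_ge0 pmulr_lle0 ?invr_gt0 ?exprn_gt0// => g2.
by apply/eqP; rewrite -sqrf_eq0 eq_le g2 sqr_ge0.
Qed.

End TrustNetworkTheory.

(* Main.v *)
(* Each cost is a quadratic polynomial in the node's own opinion, and half its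
   derivative at the equilibrium is [alpha i * (z i - s i) + (1 - alpha i) * (L z) i],
   because [|w| sgn w = w].  The first-order conditions are therefore the rows
   of the linear system [(Lambda + (I - Lambda) L) z = Lambda s]. *)


Require Import Defs.
From HB Require Import structures.
From mathcomp Require Import all_boot all_order all_algebra.
From mathcomp Require Import all_classical reals topology normedtype derive.
From mathcomp Require Import ring lra.

Set Implicit Arguments.
Unset Strict Implicit.
Unset Printing Implicit Defensive.

Import Order.TTheory GRing.Theory Num.Theory.
Import numFieldNormedType.Exports.

Local Open Scope ring_scope.

Lemma laplacian_mulmxE (R : realType) (n : nat) (G : trust_network R n)
    (z : 'cV[R]_n) (i : 'I_n) :
  (laplacian_mx G *m z) i 0 =
  \sum_(j in successors G i)
    `|trust_weight G i j| * (z i 0 - Num.sg (trust_weight G i j) * z j 0).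
Proof.
rewrite /laplacian_mx /degree_mx mulmxBl mul_diag_mx !mxE mulr_suml -sumrB.
rewrite [RHS]big_mkcond/=; apply: eq_bigr => j _; rewrite !mxE inE.
case: ifP => _; last by rewrite normr0 !mul0r subr0.
by rewrite mulrBr mulrA [_ * Num.sg _]mulrC -numEsg.
Qed.

(** The sign condition on loops is essential: up to the factor [1 - alpha i], a negative loop of
    weight w would cost 4|w|x^2, with derivative 8|w|x, while the Laplacian row would give only
    4|w|x. *)
Lemma is_derive_cost (R : realType) (n : nat) (G : trust_network R n)
    (alpha : 'I_n -> R) (s z : 'cV[R]_n) (i : 'I_n) :
  (trust_arc G i i -> 0 < trust_weight G i i) ->
  is_derive (z i 0) (1 : R)
    (fun x : R => cost G alpha s (set_opinion z i x) i)
    (2 * (alpha i * (z i 0 - s i 0)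
          + (1 - alpha i) * (laplacian_mx G *m z) i 0)).
Proof.
move=> loop.
(* A positive loop contributes nothing to the cost of its node, hence the
   factor [j != i]. *)
pose k j : R := `|trust_weight G i j| * (j != i)%:R.
pose m j : R := Num.sg (trust_weight G i j) * z j 0.
pose S (F : 'I_n -> R) := \sum_(j in successors G i) F j.
have sg1 : i \in successors G i -> Num.sg (trust_weight G i i) = 1.
  by rewrite inE => /loop; exact: gtr0_sg.
(* The coefficients do not depend on [x]: [m j] uses the fixed [z], which differs from the updated
   vector only at [j = i], where [k] vanishes. *)
have costE : (fun x : R => cost G alpha s (set_opinion z i x) i) =
    (fun x : R => (alpha i + (1 - alpha i) * S k) * x ^+ 2
      + - 2 * (alpha i * s i 0 + (1 - alpha i) * S (fun j => k j * m j)) * x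
      + (alpha i * s i 0 ^+ 2 + (1 - alpha i) * S (fun j => k j * m j ^+ 2))).
  apply/funext => x; rewrite /cost !mxE eqxx.
  rewrite (_ : \sum_(j in _) _ = S k * x ^+ 2
     - 2 * S (fun j => k j * m j) * x + S (fun j => k j * m j ^+ 2)); first by ring.
  rewrite /S mulr_sumr !mulr_suml -sumrB -big_split/=; apply: eq_bigr => j ij.
  rewrite !mxE /k /m; case: eqP => [ji|_]; last by rewrite mulr1; ring.
  by move: ij; rewrite ji => /sg1 -> /=; ring.
rewrite costE; apply: (is_derive_eq (is_derive_quadratic _ _ _ _)).
rewrite laplacian_mulmxE.
(* A positive loop also cancels in the Laplacian row, as |w| - w = 0, so [k] can replace the weights
   here too. *)
rewrite (_ : \sum_(j in _) _ = S k * z i 0 - S (fun j => k j * m j)); first by ring.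
rewrite /S mulr_suml -sumrB; apply: eq_bigr => j ij.
rewrite /k /m; case: eqP => [ji|_]; last by rewrite mulr1; ring.
by move: ij; rewrite ji => /sg1 -> /=; ring.
Qed.

(** Invertibility can fail: if n > 0, every [alpha i] is 0 and all weights are positive, the matrix
    is L, which kills constant vectors. *)
Theorem proposition2 (R : realType) (n : nat) (G : trust_network R n)
    (alpha : 'I_n -> R) (s z : 'cV[R]_n)
    (no_negative_loop :
       forall i : 'I_n, trust_arc G i i -> 0 < trust_weight G i i)
    (alpha01 : forall i : 'I_n, 0 <= alpha i <= 1)
    (s_opinion : opinion_vector s)
    (z_opinion : opinion_vector z)
    (z_nash : nash_equilibrium G alpha s z)
    (system_unit :
       confidence_mx alpha + (1%:M - confidence_mx alpha) *m laplacian_mx G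
         \in unitmx) :
  z = invmx (confidence_mx alpha
               + (1%:M - confidence_mx alpha) *m laplacian_mx G)
        *m confidence_mx alpha *m s.
Proof.
rewrite -mulmxA -[LHS](mulKmx system_unit); congr (_ *m _).
rewrite [LHS]mulmxDl -mulmxA mulmxBl mul1mx /confidence_mx !mul_diag_mx.
apply/colP => i.
(* The derivative is unique, so the computed value equals the 0 given by the equilibrium. *)
have := @derive_val _ _ _ _ _ _ _
  (is_derive_cost alpha s z (no_negative_loop i)).
rewrite (@derive_val _ _ _ _ _ _ _ (z_nash i)).
by move: (laplacian_mx G *m z) => Lz; rewrite !mxE => D0; lra.
Qed.
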